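(* In every instance of fair division with market values (with additive subjective utilities and additive market valuation, any number of agents and goods) in which the subjective utilities of all the agents induce the same ranking over the goods, there exists an allocation that is SD-EF1 both with respect to the subjective utilities and with respect to the market valuation, and such an allocation can be computed in polynomial time.
   Context: An instance of fair division with market values $\langle \mathcal{N}, \mathcal{M}, v, (u_i)_{i\in\mathcal{N}}\rangle$ consists of a finite set $\mathcal{N}$ of $n$ agents, a finite set $\mathcal{M}$ of $m$ indivisible goods, a market valuation $v:2^{\mathcal{M}}\to\mathbb{R}_{\ge 0}$, and a subjective utility function $u_i:2^{\mathcal{M}}\to\mathbb{R}_{\ge 0}$ for each agent $i$. Here all these set functions are additive: $f(S)=\sum_{g\in S} f(\{g\})$ for all $S\subseteq\mathcal{M}$, with $f(\emptyset)=0$; write $f(g)=f(\{g\})$. An allocation $A=(A_1,\dots,A_n)$ is a partition of $\mathcal{M}$ into $n$ pairwise disjoint (possibly empty) bundles, with $A_i$ given to agent $i$ and $\bigcup_i A_i=\mathcal{M}$. An additive function $f$ induces a ranking (with ties) $\pi:\mathcal{M}\to\{1,\dots,m\}$ if, for all $g,g'\in\mathcal{M}$, $\pi(g)\le\pi(g')$ if and only if $f(g)\ge f(g')$. SD-preference: for an additive $f$ and $X,Y\subseteq\mathcal{M}$, write $X \succcurlyeq^{\mathsf{SD}}_{f} Y$ if for each good $g\in\mathcal{M}$, $|\{g'\in X: f(g')\ge f(g)\}|\ge |\{g'\in Y: f(g')\ge f(g)\}|$. $A$ is SD-EF1 with respect to the subjective utilities if for every $i,j\in\mathcal{N}$, either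 $A_j=\emptyset$ or $A_i\succcurlyeq^{\mathsf{SD}}_{u_i} A_j\setminus\{g\}$ for some $g\in A_j$. $A$ is SD-EF1 with respect to the market valuation if the same holds with every $u_i$ replaced by $v$. *)

(* Defs.v *)
From HB Require Import structures.
From mathcomp Require Import all_boot all_order all_algebra.

Set Implicit Arguments.
Unset Strict Implicit.
Unset Printing Implicit Defensive.

Import Order.TTheory GRing.Theory Num.Theory.
Local Open Scope ring_scope.

Section FairDivision.

Variables (R : realFieldType) (N M : finType).

Implicit Types (f : {set M} -> R) (A : {ffun N -> {set M}}).

(* The additivity equation at [S = set0] gives [f set0 = 0]. *)
Definition additive_valuation f : Prop :=
  (forall S, 0 <= f S) /\ (forall S, f S = \sum_(g in S) f [set g]).

Record fd_instance := FDInstance {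
  market : {set M} -> R;
  subjective : N -> {set M} -> R;
  marketP : additive_valuation market;
  subjectiveP : forall i, additive_valuation (subjective i)
}.

Definition induces_ranking f (pi : M -> nat) : Prop :=
  (forall g, (1 <= pi g <= #|M|)%N) /\
  (forall g g', (pi g <= pi g')%N <-> f [set g'] <= f [set g]).

Definition same_subjective_ranking (I : fd_instance) : Prop :=
  exists pi : M -> nat, forall i, induces_ranking (subjective I i) pi.

(* Bundles may be empty, so this is not [finset.partition]. *)
Definition allocation A : Prop :=
  (forall i j, i != j -> [disjoint A i & A j]) /\
  \bigcup_i A i = [set: M].

Definition SD_pref f (X Y : {set M}) : Prop :=
  forall g, (#|[set g' in Y | (f [set g] <= f [set g'])%R]|
             <= #|[set g' in X | (f [set g] <= f [set g'])%R]|)%N.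

Definition SD_EF1 (w : N -> {set M} -> R) A : Prop :=
  forall i j, A j = set0 \/
    exists2 g, g \in A j & SD_pref (w i) (A i) (A j :\ g).

Definition SD_EF1_subjective (I : fd_instance) A : Prop :=
  SD_EF1 (subjective I) A.

Definition SD_EF1_market (I : fd_instance) A : Prop :=
  SD_EF1 (fun=> market I) A.

End FairDivision.

(* Machine model: a first-order, call-by-value functional language over       *)
(* binary trees (a pure-LISP machine, as the language F of N. D. Jones,       *)
(* "Computability and Complexity from a Programming Perspective"). Every      *)
(* construct manipulates a bounded number of pointers and costs one unit;     *)
(* there are no arithmetic and no tree-equality primitives. Representing      *)
(* trees with sharing, [t] units are simulated by a Turing machine in time    *)
(* polynomial in [t] and the sizes of input and output, and conversely; hence *)
(* for outputs of polynomial size, polynomial time here is polynomial time on *)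
(* Turing machines.                                                           *)
Inductive tree := Leaf | Node of tree & tree.

Fixpoint tree_size (x : tree) : nat :=
  if x is Node l r then (tree_size l + tree_size r).+1 else 1%N.

Definition left_of (x : tree) : tree := if x is Node l _ then l else Leaf.
Definition right_of (x : tree) : tree := if x is Node _ r then r else Leaf.

(* Each function has a single argument, denoted by [EArg] in its body. *)
Inductive term :=
  | EArg
  | ELeaf
  | ENode of term & term
  | ELeft of term
  | ERight of term
  | EIf of term & term & term
  | ECall of nat & term.

(* The [k]-th entry is the body of function [k]; functions may be mutually    *)
(* recursive, and function [0] is the entry point.                            *)
Definition program := seq term.

(* [eval P x e y t]: under argument [x], [e] terminates with value [y] after  *)
(* exactly [t] units of time. In [EIf], [Leaf] is false, other trees true.    *)
Inductive eval (P : program) : tree -> term -> tree -> nat -> Prop :=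
  | eval_arg x : eval P x EArg x 1
  | eval_leaf x : eval P x ELeaf Leaf 1
  | eval_node x e1 e2 y1 y2 t1 t2 :
      eval P x e1 y1 t1 -> eval P x e2 y2 t2 ->
      eval P x (ENode e1 e2) (Node y1 y2) (t1 + t2).+1
  | eval_left x e y t :
      eval P x e y t -> eval P x (ELeft e) (left_of y) t.+1
  | eval_right x e y t :
      eval P x e y t -> eval P x (ERight e) (right_of y) t.+1
  | eval_if_true x e e1 e2 l r y t t1 :
      eval P x e (Node l r) t -> eval P x e1 y t1 ->
      eval P x (EIf e e1 e2) y (t + t1).+1
  | eval_if_false x e e1 e2 y t t2 :
      eval P x e Leaf t -> eval P x e2 y t2 ->
      eval P x (EIf e e1 e2) y (t + t2).+1
  | eval_call x k e y z t t' :
      eval P x e y t -> eval P y (nth ELeaf P k) z t' ->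
      eval P x (ECall k e) z (t + t').+1.

Definition runs (P : program) (x y : tree) (t : nat) : Prop :=
  eval P x (nth ELeaf P 0) y t.

Definition enc_seq (s : seq tree) : tree := foldr Node Leaf s.

Definition enc_bool (b : bool) : tree := if b then Node Leaf Leaf else Leaf.

(* Binary digits, least significant first; [up_log 2 k.+1] is the number of   *)
(* digits of [k], so that [bits 0 = [::]].                                    *)
Definition bits (k : nat) : seq bool :=
  mkseq (fun i => odd (k %/ 2 ^ i)) (up_log 2 k.+1).

Definition enc_nat (k : nat) : tree := enc_seq [seq enc_bool b | b <- bits k].

(* The sign is dropped: only nonnegative values are encoded. *)
Definition enc_rat (q : rat) : tree :=
  Node (enc_nat `|numq q|%N) (enc_nat `|denq q|%N).

(* An additive set function is given by its values on single goods. *)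
Definition enc_valuation (M : finType) (f : {set M} -> rat) : tree :=
  enc_seq [seq enc_rat (f [set g]) | g <- enum M].

Definition enc_instance (N M : finType) (I : fd_instance rat N M) : tree :=
  Node (enc_valuation (market I))
       (enc_seq [seq enc_valuation (subjective I i) | i <- enum N]).

(* One row per agent: the characteristic vector of the agent's bundle. *)
Definition enc_allocation (N M : finType) (A : {ffun N -> {set M}}) : tree :=
  enc_seq [seq enc_seq [seq enc_bool (g \in A i) | g <- enum M] | i <- enum N].

(* A single program and a single polynomial serve all instances (in           *)
(* particular all numbers of agents and goods); time is measured against the  *)
(* size of the binary encoding of the instance.                               *)
Definition poly_time_solvable
    (hyp : forall N M : finType, fd_instance rat N M -> Prop)
    (sol : forall N M : finType,
       fd_instance rat N M -> {ffun N -> {set M}} -> Prop) : Prop :=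
  exists (P : program) (p : {poly nat}),
    forall (N M : finType) (I : fd_instance rat N M), hyp N M I ->
      exists (A : {ffun N -> {set M}}) (t : nat),
        [/\ sol N M I A,
            runs P (enc_instance I) (enc_allocation A) t
          & (t <= p.[tree_size (enc_instance I)]%R)%N].

(* Main.v *)
(* Ties in the common subjective ranking and in the market ranking are broken
   arbitrarily, and each of the two strict orders is cut into blocks of [n]
   consecutive goods, [n] being the number of agents. If every agent gets at
   most one good from each block of either order, then every agent gets exactly
   one good from each full block; so in an upper set of [r] goods, two bundles
   have at least [r %/ n] and at most [r %/ n + 1] goods, and removing the best
   good of a bundle gives SD-EF1. Seeing a good as an edge between its two
   blocks, such an allocation is a proper edge colouring with [n] colours of a
   bipartite multigraph of maximum degree [n], which exists by König's theorem;
   Kempe chains compute it in polynomial time. *)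

Require Import Defs.
From HB Require Import structures.
From mathcomp Require Import all_boot all_order all_algebra.
From mathcomp Require Import zify.

Set Implicit Arguments.
Unset Strict Implicit.
Unset Printing Implicit Defensive.

Import Order.TTheory GRing.Theory Num.Theory.

(** * Edge colouring of bipartite multigraphs *)

(** The colouring is a recursive function on lists, so that one object is both the witness of
    König's theorem and the specification of the program. A new edge [x] receives a colour [a] free
    at one end, while [b] is free at the other. If an edge [y] already carries [a] at that other
    end, [y] is taken out of the list and inserted again with [b], sides and colours being
    exchanged: [b] is free at the shared vertex, and the removal of [y] has freed [a] at its far
    end. The list shrinks at each step, which bounds the chain; bipartiteness fixes which of the two
    colours arrives on which side, which keeps the chain from closing up. The machine has no
    arithmetic, so ranking the goods requires comparing rationals by binary cross multiplication.
    Indices, positions and colours are bounded by the number of goods or of agents, hence by the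
    input size, so unary notation suffices for them. *)

Definition edge := (nat * (nat * nat))%type.
Definition coloured := (nat * edge)%type.

(** The side [None] stands for the good that labels the edge: the label keeps parallel edges apart,
    and lets one search function serve both the chains and the reading of the final allocation. *)
Definition key (s : option bool) (e : edge) : nat :=
  match s with None => e.1 | Some true => e.2.1 | Some false => e.2.2 end.

Arguments key : simpl never.

Definition hit s (k c : nat) (w : coloured) := (key s w.2 == k) && (w.1 == c).

Fixpoint kick s k c (U : seq coloured) : option (coloured * seq coloured) :=
  if U is w :: U' then
    if hit s k c w then Some (w, U')
    else if kick s k c U' is Some (y, V) then Some (y, w :: V) else None
  else None.

Variant kick_spec s k c U : option (coloured * seq coloured) -> Prop :=
  | KickSome y V of hit s k c y & perm_eq U (y :: V) :
      kick_spec s k c U (Some (y, V))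
  | KickNone of count (hit s k c) U = 0 : kick_spec s k c U None.

Lemma kickP s k c U : kick_spec s k c U (kick s k c U).
Proof.
elim: U => [|w U IH] /=; first by constructor.
case: ifP => [hw|hw]; first by constructor.
case: IH => [y V hy eU|eU]; last by constructor; rewrite /= hw eU.
constructor => //; rewrite -(perm_cons w) in eU.
by apply: perm_trans eU _; rewrite -cat1s -[y :: _]cat1s perm_catCA.
Qed.

Lemma kick_isSome s k c U : isSome (kick s k c U) = has (hit s k c) U.
Proof. by elim: U => //= w U <-; case: hit => //; case: kick => [[]|]. Qed.

(* The fuel [m] is at least [size U], hence never exhausted. *)
Fixpoint insert m s (a b : nat) (x : edge) (U : seq coloured) : seq coloured :=
  (a, x) ::
    match m, kick (Some (~~ s)) (key (Some (~~ s)) x) a U with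
    | m'.+1, Some (y, V) => insert m' (~~ s) b a y.2 V
    | _, _ => U
    end.

Lemma insert_edges m s a b x U :
  perm_eq (map snd (insert m s a b x U)) (x :: map snd U).
Proof.
elim: m s a b x U => [|m IH] s a b x U /=; rewrite perm_cons //.
case: kickP => [y V _ eU|//]; apply: perm_trans (IH _ _ _ _ _) _.
by rewrite perm_sym (perm_map snd eU).
Qed.

Definition proper (U : seq coloured) :=
  forall s k c, count (hit (Some s) k c) U <= 1.

(** Invariant of a Kempe chain: exchanging [a] and [b] on some edges does not change the list with
    the two colours identified, up to order. *)
Definition merge_colours (a b : nat) (w : coloured) : coloured :=
  (if w.1 == b then a else w.1, w.2).

(** Merging towards [a] and then towards [b] is merging towards [b], so the choice of representative
    does not matter. This is needed because the recursive call exchanges the colours. *)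
Lemma merge_coloursC a b U V :
  perm_eq (map (merge_colours a b) U) (map (merge_colours a b) V) ->
  perm_eq (map (merge_colours b a) U) (map (merge_colours b a) V).
Proof.
have E W : map (merge_colours b a) (map (merge_colours a b) W)
         = map (merge_colours b a) W.
  rewrite -map_comp; apply: eq_map => -[c e] /=; rewrite /merge_colours /=.
  by case: (eqVneq c b) => [->|//]; rewrite eqxx; case: eqVneq.
by move/(perm_map (merge_colours b a)); rewrite !E.
Qed.

(* The recursive call colours the kicked edge with sides and colours exchanged,
   so its last two conclusions are those of the caller in the other order; they
   keep the chain from coming back to an end of [x]. *)
Lemma insertP m s (a b : nat) x U : size U <= m -> proper U ->
    count (hit (Some s) (key (Some s) x) a) U = 0 ->
    count (hit (Some (~~ s)) (key (Some (~~ s)) x) b) U = 0 ->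
  let W := insert m s a b x U in
  [/\ proper W,
      perm_eq (map (merge_colours a b) W)
              (map (merge_colours a b) ((a, x) :: U)),
      forall k, k != key (Some s) x ->
        count (hit (Some s) k a) U = 0 -> count (hit (Some s) k a) W = 0
    & forall k, k != key (Some (~~ s)) x ->
        count (hit (Some (~~ s)) k b) U = 0 ->
        count (hit (Some (~~ s)) k b) W = 0].
Proof.
elim: m s a b x U => [|m IH] s a b x U /=.
  rewrite leqn0 size_eq0 => /eqP-> _ _ _ /=; split => //.
  - by move=> s' k c /=; case: hit.
  - by move=> k /negbTE kx _; rewrite /hit /= eq_sym kx.
  - by move=> k /negbTE kx _; rewrite /hit /= eq_sym kx.
move=> szU pU aU bU.
case: kickP => [y V|nU]; last first.
  split => //.
  - move=> s' k c /=; rewrite /hit /=.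
    case: eqP => [<-|_] /=; last exact: pU.
    case: eqP => [<-|_] /=; last exact: pU.
    case: (eqVneq s s') => [<-|/negPf nss]; first by rewrite aU.
    have -> : s' = ~~ s by case: s s' nss {aU bU nU} => -[].
    by rewrite nU.
  - by move=> k /negbTE kx /= ->; rewrite /hit /= eq_sym kx.
  - by move=> k /negbTE kx /= ->; rewrite /hit /= eq_sym kx.
case/andP=> /eqP kyx /eqP ya eU.
have cU p : count p U = p y + count p V by rewrite (permP eU).
have nab : b != a.
  apply: contra_eq_neq bU => eba.
  by rewrite cU /hit kyx ya eba !eqxx.
have pV : proper V by move=> s' k c; have := pU s' k c; rewrite cU; lia.
have szV : size V <= m by move: szU; rewrite (perm_size eU).
have bV : count (hit (Some (~~ s)) (key (Some (~~ s)) y.2) b) V = 0.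
  by move: bU; rewrite cU kyx; lia.
(* As the colouring is proper, [y] was the only edge coloured [a] at its far end. *)
have aV : count (hit (Some (~~ ~~ s)) (key (Some (~~ ~~ s)) y.2) a) V = 0.
  move: (pU s (key (Some s) y.2) a); rewrite cU negbK.
  by rewrite {1}/hit ya !eqxx; lia.
have kFxy : key (Some s) x != key (Some s) y.2.
  apply: contra_eq_neq aU => exy.
  by rewrite cU /hit exy ya !eqxx.
case: (IH (~~ s) b a y.2 V szV pV bV aV) => /=; rewrite negbK.
set W := insert _ _ _ _ _ _ => pW mW fW sW.
(* The recolouring of [y] can create colour [a] on side [s] only at the far end of [y], which is not
   an end of [x] because [a] is free at the latter. *)
have aW : count (hit (Some s) (key (Some s) x) a) W = 0.
  by apply: sW => //; move: aU; rewrite cU; lia.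
(* Exactly one edge at this vertex has a colour among [a] and [b], and merging preserves this
   number. The head of [W] is [y] recoloured [b], so no edge coloured [a] is left there. *)
have aW' : count (hit (Some (~~ s)) (key (Some (~~ s)) x) a) W = 0.
  have hb : 0 < count (hit (Some (~~ s)) (key (Some (~~ s)) x) b) W.
    by rewrite /W; case: (m) => [|m'] /=; rewrite {1}/hit /= kyx !eqxx.
  have hm Z : count (hit (Some (~~ s)) (key (Some (~~ s)) x) b)
                (map (merge_colours b a) Z)
      = count (hit (Some (~~ s)) (key (Some (~~ s)) x) a) Z
        + count (hit (Some (~~ s)) (key (Some (~~ s)) x) b) Z.
    elim: Z => //= -[c e] Z ->; rewrite /hit /=.
    case: (eqVneq c a) => [->|nca] /=.
      by rewrite eqxx [a == b]eq_sym (negbTE nab) !andbF; lia.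
    by rewrite andbF; lia.
  have := hm W; rewrite (permP mW) (hm ((b, y.2) :: V)) /= /hit /= kyx !eqxx /=.
  rewrite -/(hit _ _ _).
  have := pU (~~ s) (key (Some (~~ s)) x) a.
  rewrite cU {1}/hit kyx ya !eqxx /= (negbTE nab).
  by move: bV hb; rewrite kyx /hit; lia.
split => //.
- move=> s' k c /=; rewrite {1}/hit /=.
  case: eqP => [<-|_] /=; last exact: pW.
  case: eqP => [<-|_] /=; last exact: pW.
  case: (eqVneq s s') => [<-|/negPf nss]; first by rewrite aW.
  have -> : s' = ~~ s.
    by case: s s' nss {aU bU kyx pV bV aV kFxy W pW mW fW sW aW aW'} => -[].
  by rewrite aW'.
- rewrite perm_cons; apply: perm_trans (merge_coloursC (V := (b, y.2) :: V) mW) _.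
  rewrite perm_sym; apply: perm_trans (perm_map _ eU) _ => /=.
  by rewrite /merge_colours /= eqxx ya eq_sym (negbTE nab).
- move=> k kx akU; rewrite {1}/hit /= eq_sym (negbTE kx) /=.
  apply: sW; last by move: akU; rewrite cU; lia.
  apply: contra_eq_neq akU => ->.
  by rewrite cU /hit ya !eqxx.
- move=> k kx bkU; rewrite {1}/hit /= eq_sym (negbTE kx) /=.
  apply: fW; first by rewrite kyx.
  by move: bkU; rewrite cU; lia.
Qed.

Fixpoint free_colour s k n (U : seq coloured) : nat :=
  if n is c.+1 then if kick s k c U then free_colour s k c U else c else 0.

(** Pigeonhole. The count is first restricted to edges coloured below [n], so that it drops by at
    least one whenever the search finds the top colour taken. *)
Lemma free_colourP s (k n : nat) U :
  count (fun w : coloured => key s w.2 == k) U < n ->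
  free_colour s k n U < n /\ count (hit s k (free_colour s k n U)) U = 0.
Proof.
have: count (fun w : coloured => (key s w.2 == k) && (w.1 < n)) U
      <= count (fun w : coloured => key s w.2 == k) U.
  by apply: sub_count => w /andP[].
move/leq_ltn_trans => H /H{H}.
elim: n => // n IH /=.
have -> : count (fun w : coloured => (key s w.2 == k) && (w.1 < n.+1)) U =
    count (fun w : coloured => (key s w.2 == k) && (w.1 < n)) U
    + count (hit s k n) U.
  elim: U {IH} => //= w U ->; rewrite /hit.
  by case: (key s w.2 == k) => //=; case: (ltngtP w.1 n); lia.
case: kickP => [y V hy eU|eU] lt; last by rewrite eU.
have lt1 : 0 < count (hit s k n) U by rewrite (permP eU) /= hy.
by case: IH => [|lt2 -> /=]; [lia | split => //; lia].
Qed.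

Fixpoint colour n (es : seq edge) : seq coloured :=
  if es is e :: es' then
    let W := colour n es' in
    insert (size W) true (free_colour (Some true) (key (Some true) e) n W)
                         (free_colour (Some false) (key (Some false) e) n W) e W
  else [::].

Lemma colour_edges n es : perm_eq (map snd (colour n es)) es.
Proof.
elim: es => //= e es IH; apply: perm_trans (insert_edges _ _ _ _ _ _) _.
by rewrite perm_cons.
Qed.

Lemma colourP n es :
    (forall s k, count (fun e => key (Some s) e == k) es <= n) ->
  let W := colour n es in
  proper W /\ all (fun w => w.1 < n) W.
Proof.
elim: es => [|e es IH] //= Hes.
have /IH[] : forall s k, count (fun e => key (Some s) e == k) es <= n.
  by move=> s k; have := Hes s k; lia.
move: {IH} (colour n es) (colour_edges n es) => W eW pW lW.
(* The new edge counts towards the degree of each of its ends, so fewer than [n] edges of [W] meet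
   there. *)
have Hfree s : free_colour (Some s) (key (Some s) e) n W < n /\
   count (hit (Some s) (key (Some s) e) (free_colour (Some s) (key (Some s) e) n W)) W
     = 0.
  apply: free_colourP; have := Hes s (key (Some s) e).
  by rewrite eqxx -(permP eW) count_map.
have [[la ca] [lb cb]] := (Hfree true, Hfree false).
move: (free_colour (Some true) _ _ _) la ca => a la ca.
move: (free_colour (Some false) _ _ _) lb cb => b lb cb.
have [pW' mW' _ _] := insertP (leqnn _) pW ca cb.
split => //.
(* The range of the colours is read off the merged list: the colour hidden by the merging is [b],
   itself below [n]. *)
have : all (fun w => w.1 < n) (map (merge_colours a b) ((a, e) :: W)).
  rewrite all_map; apply/allP => -[c f] /=; rewrite inE.
  case/orP=> [/eqP[-> _]|/(allP lW)/=]; first by case: ifP.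
  by case: ifP.
rewrite -(perm_all _ mW') all_map; apply: sub_all => -[c f] /=.
by case: eqP => // ->.
Qed.

(** * Balanced allocations *)

Section Positions.
Variables (R : realFieldType) (M : finType).
Implicit Types (u : M -> R) (c : M -> nat).

(** Values are tested only by [<=], the comparison that the program implements; index order settles
    ties and makes the order strict and total. *)
Definition precedes u (g h : M) : bool :=
  if (u g <= u h)%R then (u h <= u g)%R && (index g (enum M) < index h (enum M))
  else true.

Definition position u (g : M) : nat := #|[set h | precedes u h g]|.

Lemma precedesxx u g : precedes u g g = false.
Proof. by rewrite /precedes lexx ltnn. Qed.

Lemma precedes_total u g h : g != h -> precedes u g h || precedes u h g.
Proof.
rewrite /precedes => ngh; case: ltgtP => //= _.
rewrite -neq_ltn; apply: contra ngh => /eqP e.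
by rewrite -(nth_index g (_ : g \in enum M)) ?e ?nth_index ?mem_enum.
Qed.

Lemma precedes_trans u : transitive (precedes u).
Proof.
move=> h g k; rewrite /precedes.
case: (ltgtP (u g) (u h)) => // gh; case: (ltgtP (u h) (u k)) => //= hk.
- by rewrite leNgt (lt_trans hk gh).
- by rewrite -hk leNgt gh.
- by rewrite gh leNgt hk.
- by rewrite gh hk lexx; apply: ltn_trans.
Qed.

Lemma position_mono u g h : precedes u g h -> position u g < position u h.
Proof.
move=> gh; apply: proper_card; apply/properP; split.
  by apply/subsetP => k; rewrite !inE => /precedes_trans; apply.
by exists g; rewrite !inE ?precedesxx.
Qed.

Lemma position_inj u : injective (position u).
Proof.
move=> g h e; apply/eqP; apply/idPn => /(precedes_total u).
by case/orP=> /position_mono; rewrite e ltnn.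
Qed.

Lemma position_lt u g : position u g < #|M|.
Proof.
rewrite -cardsT; apply: proper_card; apply/properP; split; first exact: subsetT.
by exists g; rewrite !inE // precedesxx.
Qed.

Lemma position_onto u p : p < #|M| -> exists g, position u g = p.
Proof.
move=> lt_p; pose F g : 'I_#|M| := Ordinal (position_lt u g).
have Finj : injective F by move=> g h /(congr1 val)/position_inj.
have [|G _ FG] := inj_card_bij Finj; first by rewrite card_ord.
by exists (G (Ordinal lt_p)); have := congr1 val (FG (Ordinal lt_p)).
Qed.

(** Whatever the tie-breaking, an upper set is an initial segment of positions: all predecessors of
    a member are members, and every member precedes every non-member. Hence SD comparisons become
    counts in initial segments. *)
Lemma position_upper_set u t g :
  (u t <= u g)%R = (position u g < #|[set h | u t <= u h]%R|).
Proof.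
case: (leP (u t) (u g)) => tg; apply/esym.
  apply: proper_card; apply/properP; split.
    apply/subsetP => h; rewrite !inE /precedes.
    by case: (leP (u h) (u g)) => [_ /andP[gh _]|/ltW gh _]; apply: le_trans gh.
  by exists g; rewrite !inE ?precedesxx.
apply/negbTE; rewrite -leqNgt; apply: subset_leq_card; apply/subsetP => h.
by rewrite !inE /precedes => th; rewrite leNgt (lt_le_trans tg th).
Qed.

Definition balanced n u c :=
  forall g h, c g = c h -> position u g %/ n = position u h %/ n -> g = h.

Lemma balanced_lower n u c i r : balanced n u c -> (forall g, c g < n) ->
  i < n -> r <= #|M| ->
  r %/ n <= #|[set g | c g == i & position u g < r]|.
Proof.
move=> bal cn lt_in le_r.
have n0 : 0 < n by lia.
have H (k : 'I_(r %/ n)) : exists g, c g = i /\ position u g %/ n = k.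
  (* Block [k] is full: it ends at [k.+1 * n], which is at most [r], hence at most the number of
     goods. *)
  have Hp (a : 'I_n) : exists g, position u g = k * n + a.
    apply: position_onto; apply: leq_trans le_r.
    have := leq_mul (ltn_ord k) (leqnn n); have := leq_trunc_div r n.
    by have := ltn_ord a; lia.
  have [G HG] := fin_all_exists Hp.
  have divG a : position u (G a) %/ n = k.
    by rewrite HG divnMDl // (divn_small (ltn_ord a)) addn0.
  (* Balance makes the map from places of the block to colours injective, hence onto, so the colour
     [i] occurs in the block. *)
  pose F a : 'I_n := Ordinal (cn (G a)).
  have Finj : injective F.
    move=> a b /(congr1 val) /= /bal.
    rewrite !divG => /(_ erefl) eG; apply: val_inj => /=.
    by have := HG a; rewrite eG HG; lia.
  have [|F' _ FK] := inj_card_bij Finj; first by [].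
  exists (G (F' (Ordinal lt_in))); split => //.
  by have := congr1 val (FK (Ordinal lt_in)).
have [G HG] := fin_all_exists H.
have Ginj : injective G.
  by move=> k l e; apply: val_inj; rewrite /= -(HG k).2 -(HG l).2 e.
rewrite -[X in X <= _]card_ord -(card_imset _ Ginj); apply: subset_leq_card.
apply/subsetP => _ /imsetP[k _ ->]; rewrite inE (HG k).1 eqxx /=.
rewrite ltnNge; apply/negP => /(leq_div2r n).
by rewrite (HG k).2 leqNgt ltn_ord.
Qed.

(** Positions below [r] meet only the blocks [0] to [r %/ n], and a colour occurs at most once in
    each. *)
Lemma balanced_upper n u c i r : balanced n u c -> 
  #|[set g | c g == i & position u g < r]| <= (r %/ n).+1.
Proof.
move=> bal; set S := [set g | _].
pose F g : 'I_(r %/ n).+1 := inord (position u g %/ n).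
have FE g : g \in S -> F g = position u g %/ n :> nat.
  by rewrite inE => /andP[_ /ltnW lt]; rewrite inordK // ltnS leq_div2r.
have Finj : {in S &, injective F}.
  move=> g h gS hS /(congr1 val); rewrite /= !FE // => e; apply: bal => //.
  by move: gS hS; rewrite !inE => /andP[/eqP-> _] /andP[/eqP-> _].
by rewrite -(card_in_imset Finj) -[X in _ <= X]card_ord max_card.
Qed.

Lemma balanced_EF1 (f : {set M} -> R) n c i j :
    balanced n (fun g => f [set g]) c -> (forall g, c g < n) -> i < n ->
  [set g | c g == j] = set0 \/
  exists2 g, g \in [set g | c g == j] &
    SD_pref f [set g | c g == i] ([set g | c g == j] :\ g).
Proof.
set u := fun g => _; move=> bal cn lt_in.
have [-> | [g0 g0j]] := set_0Vmem [set g | c g == j]; [by left | right].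
pose g := [arg min_(g < g0 in [set g | c g == j]) position u g].
have [gj gmin] : g \in [set g | c g == j] /\
    forall h, h \in [set g | c g == j] -> position u g <= position u h.
  by rewrite /g; case: arg_minnP.
exists g => // t; set r := #|[set h | u t <= u h]%R|.
have upE (X : {set M}) :
    [set h in X | (f [set t] <= f [set h])%R] = [set h in X | position u h < r].
  by apply/setP => h; rewrite !inE -position_upper_set.
rewrite !upE.
have -> : [set h in [set g | c g == i] | position u h < r]
        = [set h | c h == i & position u h < r].
  by apply/setP => h; rewrite !inE.
apply: leq_trans (balanced_lower bal cn lt_in (max_card _)).
(* If the best good of bundle [j] is outside the upper set, so is the whole bundle; otherwise
   removing it lowers the upper count by one. *)
have [lt_gr | le_rg] := ltnP (position u g) r; last first.
  rewrite (_ : [set h in _ | _] = set0) ?cards0 //; apply/setP => h.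
  rewrite !inE; apply/negbTE; apply/negP => /andP[/andP[_ hj] lt_h].
  have := gmin h; rewrite inE hj => /(_ isT); lia.
rewrite -ltnS; apply: leq_trans (balanced_upper j r bal).
apply: proper_card; apply/properP; split.
  by apply/subsetP => h; rewrite !inE => /andP[/andP[_ ->] ->].
by exists g; rewrite !inE ?eqxx //= lt_gr andbT; move: gj; rewrite inE.
Qed.

End Positions.

(** * From edge colourings to allocations *)

Lemma count_le1_inj (T : eqType) (p : pred T) s x y :
  count p s <= 1 -> x \in s -> y \in s -> p x -> p y -> x = y.
Proof.
move=> le1 xs ys px py; apply/eqP; apply: contraLR le1 => nxy.
rewrite -ltnNge (permP (perm_to_rem xs)) /= px.
rewrite (permP (perm_to_rem (_ : y \in rem x s))) /= ?py //.
apply: contraR nxy => yrem; have := perm_mem (perm_to_rem xs) y.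
by rewrite ys inE (negbTE yrem) orbF eq_sym => <-.
Qed.

Lemma index_enum_inj (T : finType) : injective (fun x : T => index x (enum T)).
Proof.
by move=> x y e; rewrite -(nth_index x (mem_enum T x)) e nth_index ?mem_enum.
Qed.

Lemma index_enum_lt (T : finType) (x : T) : index x (enum T) < #|T|.
Proof. by rewrite cardE index_mem mem_enum. Qed.

Section Allocation.
Variables (R : realFieldType) (N M : finType).
Implicit Types (u v : M -> R).

(** This is the degree bound of the multigraph: positions in one block differ modulo [n]. The last
    block may be short, so the graph need not be regular. *)
Lemma card_block u n k : 0 < n -> #|[set g | position u g %/ n == k]| <= n.
Proof.
move=> n0; pose F g : 'I_n := Ordinal (ltn_pmod (position u g) n0).
rewrite -[X in _ <= X]card_ord -(@card_in_imset _ _ F) ?max_card // => g h.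
rewrite !inE => /eqP gk /eqP hk /(congr1 val) /= e.
apply: (@position_inj _ _ u).
by rewrite (divn_eq (position u g) n) gk e -hk -divn_eq.
Qed.

Definition good_edge n u v (g : M) : edge :=
  (index g (enum M), (position u g %/ n, position v g %/ n)).

Definition good_edges n u v : seq edge := [seq good_edge n u v g | g <- enum M].

Definition allot (W : seq coloured) : {ffun N -> {set M}} :=
  [ffun i => [set g | has (hit None (index g (enum M)) (index i (enum N))) W]].

(** Each good labels exactly one edge, so the coloured list is the graph of a function on goods;
    properness on the two sides becomes balance for the two orders. *)
Lemma colour_good_edges n u v : 0 < n ->
  exists c : M -> nat,
    [/\ forall g k, has (hit None (index g (enum M)) k)
                        (colour n (good_edges n u v)) = (c g == k),
        forall g, c g < n, balanced n u c & balanced n v c].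
Proof.
move=> n0.
have [|pW lW] := @colourP n (good_edges n u v).
  move=> s k; rewrite count_map.
  suff H : forall w : M -> R,
      count (fun g => position w g %/ n == k) (enum M) <= n.
    by case: s; exact: H.
  move=> w; apply: leq_trans (card_block w k n0).
  rewrite enumT cardE /enum_mem size_filter.
  by apply: sub_count => g /=; rewrite inE.
move: (colour _ _) (colour_edges n (good_edges n u v)) pW lW => W eW pW lW.
have uniq_key g : count (fun w : coloured => key None w.2 == index g (enum M)) W
   <= 1.
  rewrite -(count_map snd (fun e => key None e == _)) (permP eW) count_map.
  rewrite -[X in X <= _](@eq_in_count _ (pred1 g)) ?count_uniq_mem ?enum_uniq
          ?leq_b1 //.
  move=> h _ /=; rewrite /key /=; apply/eqP/eqP => [->//|e].
  by apply: index_enum_inj.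
have H g : exists w, w \in W /\ w.2 = good_edge n u v g.
  have : good_edge n u v g \in map snd W.
    by rewrite (perm_mem eW) map_f ?mem_enum.
  by case/mapP => w wW ->; exists w.
have [w Hw] := fin_all_exists H.
have w_inj g h : w g = w h -> g = h.
  move=> e; have [_ Eg] := Hw g; have [_ Eh] := Hw h.
  have [] : good_edge n u v g = good_edge n u v h by rewrite -Eg e.
  by move=> /index_enum_inj->.
exists (fun g => (w g).1); split.
- move=> g k; have [wW Eg] := Hw g; apply/hasP/eqP => [[x xW /andP[kx /eqP <-]]|<-].
    congr fst; apply: (count_le1_inj (uniq_key g)) => //.
    by rewrite Eg /key.
  by exists (w g); rewrite // /hit Eg !eqxx.
- by move=> g; have [/(allP lW)] := Hw g.
- move=> g h e pe; apply: w_inj; have [gW Eg] := Hw g; have [hW Eh] := Hw h.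
  apply: (count_le1_inj (pW true (position u g %/ n) (w g).1)) => //.
    by rewrite /hit Eg !eqxx.
  by rewrite /hit Eh e pe !eqxx.
- move=> g h e pe; apply: w_inj; have [gW Eg] := Hw g; have [hW Eh] := Hw h.
  apply: (count_le1_inj (pW false (position v g %/ n) (w g).1)) => //.
    by rewrite /hit Eg !eqxx.
  by rewrite /hit Eh e pe !eqxx.
Qed.

Lemma allotP (I : fd_instance R N M) (i0 : N) : same_subjective_ranking I ->
  let A := allot (colour #|N|
             (good_edges #|N| (fun g => market I [set g])
                              (fun g => subjective I i0 [set g]))) in
  [/\ allocation A, SD_EF1_subjective I A & SD_EF1_market I A].
Proof.
case=> pi Hpi.
have n0 : 0 < #|N| by apply/card_gt0P; exists i0.
have [c [hc cn bm bs]] := colour_good_edges (fun g => market I [set g])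
  (fun g => subjective I i0 [set g]) n0.
set W := colour _ _ in hc *.
have AE i : allot W i = [set g | c g == index i (enum N)].
  by apply/setP => g; rewrite ffunE !inE hc.
split.
- split=> [i j nij|].
    rewrite !AE -setI_eq0; apply/eqP/setP => g; rewrite !inE.
    apply/negbTE; apply: contra nij => /andP[/eqP -> /eqP e].
    by rewrite (index_enum_inj e).
  apply/setP => g; rewrite inE; apply/bigcupP.
  have lt : c g < size (enum N) by rewrite -cardE.
  exists (nth i0 (enum N) (c g)) => //.
  by rewrite AE inE index_uniq ?enum_uniq.
- move=> i j; rewrite !AE.
  have [->|[g gj H]] := balanced_EF1 (index j (enum N)) bs cn (index_enum_lt i).
    by left.
  right; exists g => // t.
  (* A common ranking gives agents [i] and [i0] the same upper sets, so balance with respect to [i0]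
     is enough. *)
  have E (X : {set M}) :
      [set h in X | (subjective I i [set t] <= subjective I i [set h])%R]
    = [set h in X | (subjective I i0 [set t] <= subjective I i0 [set h])%R].
    apply/setP => h; rewrite !inE; congr (_ && _).
    by apply/idP/idP => /(Hpi _).2/(Hpi _).2.
  by rewrite !E.
- by move=> i j; rewrite !AE; apply: balanced_EF1 bm cn (index_enum_lt i).
Qed.

End Allocation.

(** * The program *)

Local Notation arg := EArg.
Local Notation lft := ELeft.
Local Notation rgt := ERight.
Local Notation "<< x , y >>" := (ENode x y).
Local Notation etrue := (ENode ELeaf ELeaf).
Local Notation efalse := ELeaf.
Local Notation esucc := (ENode ELeaf).

Local Notation f_main := 0.
Local Notation f_solve := 1.
Local Notation f_leq := 2.
Local Notation f_add := 3.
Local Notation f_mul := 4.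
Local Notation f_cmp := 5.
Local Notation f_le_rat := 6.
Local Notation f_precedes := 7.
Local Notation f_position := 8.
Local Notation f_div := 9.
Local Notation f_number := 10.
Local Notation f_blocks := 11.
Local Notation f_edges := 12.
Local Notation f_hit := 13.
Local Notation f_kick := 14.
Local Notation f_kick_cons := 15.
Local Notation f_insert := 16.
Local Notation f_insert_step := 17.
Local Notation f_free := 18.
Local Notation f_colour := 19.
Local Notation f_colour_step := 20.
Local Notation f_row := 21.
Local Notation f_rows := 22.
Local Notation f_length := 23.

Definition body_leq : term :=
  EIf (lft arg)
      (EIf (rgt arg) (ECall f_leq << rgt (lft arg), rgt (rgt arg) >>) efalse)
      etrue.

(* [c] is the carry; as [left_of Leaf] and [right_of Leaf] are [Leaf], the
   shorter number is padded with zeros. *)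
Definition body_add : term :=
  let c := lft arg in let x := lft (rgt arg) in let y := rgt (rgt arg) in
  let digit s c' := << s, ECall f_add << c', << rgt x, rgt y >> >> >> in
  let step :=
    EIf c (EIf (lft x) (EIf (lft y) (digit etrue etrue) (digit efalse etrue))
                       (EIf (lft y) (digit efalse etrue) (digit etrue efalse)))
          (EIf (lft x) (EIf (lft y) (digit efalse etrue) (digit etrue efalse))
                       (EIf (lft y) (digit etrue efalse) (digit efalse efalse)))
  in EIf x step (EIf y step (EIf c << etrue, ELeaf >> ELeaf)).

Definition body_mul : term :=
  let x := lft arg in let y := rgt arg in
  let double := << efalse, ECall f_mul << rgt x, y >> >> in
  EIf x (EIf (lft x) (ECall f_add << efalse, << y, double >> >>) double) ELeaf.

(* [c] is the outcome of the comparison of the lower digits. *)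
Definition body_cmp : term :=
  let c := lft arg in let x := lft (rgt arg) in let y := rgt (rgt arg) in
  let step :=
    ECall f_cmp << EIf (lft x) (EIf (lft y) c efalse) (EIf (lft y) etrue c),
                   << rgt x, rgt y >> >>
  in EIf x step (EIf y step c).

(** Cross multiplication; starting the comparison from the outcome [etrue] makes it non-strict. *)
Definition body_le_rat : term :=
  let p := lft arg in let q := rgt arg in
  ECall f_cmp << etrue, << ECall f_mul << lft p, rgt q >>,
                           ECall f_mul << lft q, rgt p >> >> >>.

Definition body_precedes : term :=
  let x := lft arg in let y := rgt arg in
  EIf (ECall f_le_rat << rgt x, rgt y >>)
      (EIf (ECall f_le_rat << rgt y, rgt x >>)
           (EIf (ECall f_leq << lft y, lft x >>) efalse etrue)
           efalse)
      etrue.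

Definition body_position : term :=
  let x := lft arg in let s := rgt arg in
  let rec := ECall f_position << x, rgt s >> in
  EIf s (EIf (ECall f_precedes << lft s, x >>) (esucc rec) rec) ELeaf.

(* Here and below, [n'] is the predecessor of the number of agents; the value is
   the quotient of [p + (n' - r)] by [n'.+1]. *)
Definition body_div : term :=
  let n' := lft arg in let r := lft (rgt arg) in let p := rgt (rgt arg) in
  EIf p (EIf r (ECall f_div << n', << rgt r, rgt p >> >>)
               (esucc (ECall f_div << n', << n', rgt p >> >>)))
        ELeaf.

Definition body_number : term :=
  let k := lft arg in let s := rgt arg in
  EIf s << << k, lft s >>, ECall f_number << esucc k, rgt s >> >> ELeaf.

Definition body_blocks : term :=
  let n' := lft arg in let all := lft (rgt arg) in let s := rgt (rgt arg) in
  EIf s << ECall f_div << n', << n', ECall f_position << lft s, all >> >> >>,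
           ECall f_blocks << n', << all, rgt s >> >> >>
        ELeaf.

Definition body_edges : term :=
  let k := lft arg in let s := lft (rgt arg) in let t := rgt (rgt arg) in
  EIf s << << k, << lft s, lft t >> >>,
           ECall f_edges << esucc k, << rgt s, rgt t >> >> >>
        ELeaf.

(** Equality of unary numbers is tested by two comparisons, the machine having no equality. The
    inner [EIf s] separates the side [None], encoded by [Leaf], from a wrapped boolean. *)
Definition body_hit : term :=
  let s := lft (lft arg) in
  let k := lft (rgt (lft arg)) in let c := rgt (rgt (lft arg)) in
  let c' := lft (rgt arg) in let e := rgt (rgt arg) in
  let k' := EIf s (EIf (lft s) (lft (rgt e)) (rgt (rgt e))) (lft e) in
  EIf (ECall f_leq << k', k >>)
    (EIf (ECall f_leq << k, k' >>)
      (EIf (ECall f_leq << c', c >>) (ECall f_leq << c, c' >>) efalse)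
      efalse)
    efalse.

Definition body_kick : term :=
  let q := lft arg in let U := rgt arg in
  EIf U (EIf (ECall f_hit << q, lft U >>) U
             (ECall f_kick_cons << lft U, ECall f_kick << q, rgt U >> >>))
        ELeaf.

(** The language has no local binding, so a separate function names the result of the recursive
    call; repeating the call at each use would cost exponential time. The two step functions below
    have the same purpose. *)
Definition body_kick_cons : term :=
  let w := lft arg in let r := rgt arg in
  EIf r << lft r, << w, rgt r >> >> ELeaf.

Definition body_insert : term :=
  let s := lft (lft arg) in let a := lft (rgt (lft arg)) in
  let x := lft (rgt arg) in let U := rgt (rgt arg) in
  ECall f_insert_step
    << ECall f_kick << << EIf s << efalse, ELeaf >> << etrue, ELeaf >>,
                          << EIf s (rgt (rgt x)) (lft (rgt x)), a >> >>, U >>,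
       arg >>.

Definition body_insert_step : term :=
  let r := lft arg in let s := lft (lft (rgt arg)) in
  let a := lft (rgt (lft (rgt arg))) in let b := rgt (rgt (lft (rgt arg))) in
  let x := lft (rgt (rgt arg)) in let U := rgt (rgt (rgt arg)) in
  << << a, x >>,
     EIf r (ECall f_insert << << EIf s efalse etrue, << b, a >> >>,
                              << rgt (lft r), rgt r >> >>)
           U >>.

Definition body_free : term :=
  let s := lft (lft arg) in let k := rgt (lft arg) in
  let n := lft (rgt arg) in let U := rgt (rgt arg) in
  EIf n (EIf (ECall f_kick << << s, << k, rgt n >> >>, U >>)
             (ECall f_free << << s, k >>, << rgt n, U >> >>)
             (rgt n))
        ELeaf.

Definition body_colour : term :=
  let n := lft arg in let es := rgt arg in
  EIf es (ECall f_colour_step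
            << n, << lft es, ECall f_colour << n, rgt es >> >> >>)
         ELeaf.

Definition body_colour_step : term :=
  let n := lft arg in let e := lft (rgt arg) in let W := rgt (rgt arg) in
  let free s k := ECall f_free << << << s, ELeaf >>, k >>, << n, W >> >> in
  ECall f_insert
    << << etrue, << free etrue (lft (rgt e)), free efalse (rgt (rgt e)) >> >>,
       << e, W >> >>.

Definition body_row : term :=
  let k := lft arg in let es := lft (rgt arg) in let W := rgt (rgt arg) in
  EIf es
    << EIf (ECall f_kick << << ELeaf, << lft (lft es), k >> >>, W >>)
           etrue efalse,
       ECall f_row << k, << rgt es, W >> >> >>
    ELeaf.

(** The list [s] of valuations acts as a counter: each element yields one row. *)
Definition body_rows : term :=
  let k := lft arg in let s := lft (rgt arg) in let data := rgt (rgt arg) in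
  EIf s << ECall f_row << k, data >>,
           ECall f_rows << esucc k, << rgt s, data >> >> >>
        ELeaf.

Definition body_length : term :=
  EIf arg (esucc (ECall f_length (rgt arg))) ELeaf.

Definition body_solve : term :=
  let s := lft arg in let es := rgt arg in
  ECall f_rows << ELeaf, << s, << es,
    ECall f_colour << ECall f_length s, es >> >> >> >>.

(** Subjective blocks are computed from the first agent, who represents the common ranking. Dropping
    one unit of the unary length gives the predecessor expected by the division. *)
Definition body_main : term :=
  let v := ECall f_number << ELeaf, lft arg >> in
  let u := ECall f_number << ELeaf, lft (rgt arg) >> in
  let n' := rgt (ECall f_length (rgt arg)) in
  ECall f_solve << rgt arg, ECall f_edges << ELeaf,
    << ECall f_blocks << n', << v, v >> >>,
       ECall f_blocks << n', << u, u >> >> >> >> >>.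

Definition sd_program : program :=
  [:: body_main; body_solve; body_leq; body_add; body_mul; body_cmp;
      body_le_rat; body_precedes; body_position; body_div; body_number;
      body_blocks; body_edges; body_hit; body_kick; body_kick_cons;
      body_insert; body_insert_step; body_free; body_colour; body_colour_step;
      body_row; body_rows; body_length].

(** * Running times *)

Definition eval_within x e y T := exists2 t, eval sd_program x e y t & t <= T.

Definition computes k x y T := eval_within x (nth ELeaf sd_program k) y T.

Lemma computesI k e x y T :
  nth ELeaf sd_program k = e -> eval_within x e y T -> computes k x y T.
Proof. by move=> <-. Qed.

Lemma computes_le k x y T T' : computes k x y T -> T <= T' -> computes k x y T'.
Proof. by case=> t ev le_t le_T; exists t => //; apply: leq_trans le_T. Qed.

Lemma within_eq x e y y' T T' :
  eval_within x e y T -> y = y' -> T <= T' -> eval_within x e y' T'.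
Proof. by case=> t ev le_t <- le_T; exists t => //; apply: leq_trans le_T. Qed.

Lemma within_arg x : eval_within x EArg x 1.
Proof. by exists 1 => //; constructor. Qed.

Lemma within_leaf x : eval_within x ELeaf Leaf 1.
Proof. by exists 1 => //; constructor. Qed.

Lemma within_node x e1 e2 y1 y2 T1 T2 :
  eval_within x e1 y1 T1 -> eval_within x e2 y2 T2 ->
  eval_within x (ENode e1 e2) (Node y1 y2) (T1 + T2).+1.
Proof.
by case=> t1 ev1 le1 [t2 ev2 le2]; exists (t1 + t2).+1; [constructor | lia].
Qed.

Lemma within_left x e y T :
  eval_within x e y T -> eval_within x (ELeft e) (left_of y) T.+1.
Proof. by case=> t ev le_t; exists t.+1; [constructor | lia]. Qed.

Lemma within_right x e y T :
  eval_within x e y T -> eval_within x (ERight e) (right_of y) T.+1.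
Proof. by case=> t ev le_t; exists t.+1; [constructor | lia]. Qed.

(** One rule for both outcomes: the branch is a match on the value of the test, which [simpl]
    resolves once this value is known. *)
Lemma within_if x e e1 e2 z y T T' :
  eval_within x e z T ->
  eval_within x (if z is Node _ _ then e1 else e2) y T' ->
  eval_within x (EIf e e1 e2) y (T + T').+1.
Proof.
case=> t ev le_t; case: z ev => [|l r] ev [t' ev' le_t'];
  exists (t + t').+1; try lia.
  exact: eval_if_false ev ev'.
exact: eval_if_true ev ev'.
Qed.

Lemma within_call x k e y z T T' :
  eval_within x e y T -> computes k y z T' ->
  eval_within x (ECall k e) z (T + T').+1.
Proof.
case=> t ev le_t [t' ev' le_t']; exists (t + t').+1; last by lia.
exact: eval_call ev ev'.
Qed.

Ltac symbolic_eval :=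
  lazymatch goal with
  | |- eval_within _ EArg _ _ => exact: within_arg
  | |- eval_within _ ELeaf _ _ => exact: within_leaf
  | |- eval_within _ (ENode _ _) _ _ => eapply within_node; symbolic_eval
  | |- eval_within _ (ELeft _) _ _ => eapply within_left; symbolic_eval
  | |- eval_within _ (ERight _) _ _ => eapply within_right; symbolic_eval
  | |- eval_within _ (EIf _ _ _) _ _ =>
      eapply within_if; [symbolic_eval | simpl; symbolic_eval]
  | |- eval_within _ (ECall _ _) _ _ =>
      eapply within_call; [symbolic_eval | simpl;
        match goal with
        | H : computes ?k ?x _ _ |- computes ?k' ?x' _ _ =>
            constr_eq k k'; constr_eq x x'; exact: H
        | _ => eassumption
        end]
  end.

(* Calls are resolved by the hypotheses of the form [computes _ _ _ _]. *)
Ltac run body :=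
  apply: (@computesI _ body); [reflexivity | rewrite /body /=];
  eapply within_eq; [symbolic_eval | simpl | ].

(** * Unary and binary arithmetic on the machine *)

Fixpoint unary (k : nat) : tree := if k is k'.+1 then Node Leaf (unary k') else Leaf.

(** The minimum matters: in [computes_hit] the query is bounded but the coloured edge is
    arbitrary. *)
Lemma computes_leq a b :
  computes f_leq (Node (unary a) (unary b)) (enc_bool (a <= b))
           (40 * (minn a b).+1).
Proof.
elim: a b => [|a IH] [|b]; try by run body_leq; [|lia].
have IHb := IH b.
by run body_leq; [|lia].
Qed.

Definition enc_bits (x : seq bool) := enc_seq (map enc_bool x).

Fixpoint bits_val (x : seq bool) : nat :=
  if x is b :: x' then b + (bits_val x').*2 else 0.

Lemma bits_val_head x : bits_val x = head false x + (bits_val (behead x)).*2.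
Proof. by case: x. Qed.

(** Results may have leading zeros, so they are specified by value and length instead of as [bits]
    of a number. The length bound keeps later operations cheap. *)
Lemma computes_add c x y : exists z,
  [/\ computes f_add (Node (enc_bool c) (Node (enc_bits x) (enc_bits y)))
               (enc_bits z) (100 * (size x + size y).+1),
      bits_val z = c + bits_val x + bits_val y &
      size z <= (maxn (size x) (size y)).+1].
Proof.
have [m] := ubnP (size x + size y); elim: m c x y => // m IH c x y le_m.
case E: ((size x == 0) && (size y == 0)).
  move: E; rewrite !size_eq0 => /andP[/eqP-> /eqP->].
  case: c; [exists [:: true] | exists [::]]; split=> //;
    by run body_add; [| lia].
have {}E : 0 < size x + size y by move: E; lia.
pose s := c + head false x + head false y.
have [|z [Hz vz sz]] := IH (2 <= s) (behead x) (behead y).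
  by rewrite !size_behead; move: E le_m; lia.
exists (odd s :: z); split; last first.
- by move: sz E; rewrite /= !size_behead; lia.
- rewrite /= vz (bits_val_head x) (bits_val_head y) /s.
  by case: (c) (head _ x) (head _ y) => [] [] [] /=; lia.
move: Hz; rewrite /s => {IH le_m s vz sz} Hz.
case: x y E Hz => [|[] x] [|[] y] // _; case: c => /= Hz;
  by run body_add; [| rewrite /=; lia].
Qed.

(** With [K] fixed, the cost of one digit of [x] is constant. The partial product has at most
    [3 * K] digits, and adding [y] to its double accounts for the factor [4 * K]. *)
Lemma computes_mul K x y : size x <= K -> size y <= K -> exists z,
  [/\ computes f_mul (Node (enc_bits x) (enc_bits y)) (enc_bits z)
        ((size x).+1 * (100 * (4 * K + 10))),
      bits_val z = bits_val x * bits_val y &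
      size z <= (size x).*2 + size y].
Proof.
move=> + le_y; elim: x => [|b x IH] le_x.
  by exists [::]; split => //; run body_mul; [| lia].
have [|z [Hz vz sz]] := IH; first by apply: ltnW.
have [z' [Hz' vz' sz']] := computes_add false y (false :: z).
case: b le_x => le_x.
  exists z'; split; last by move: sz' le_x => /=; lia.
    move: le_x sz => /= le_x sz; run body_mul => //.
    have : 100 * (size y + (size z).+1).+1 + 50 <= 100 * (4 * K + 10) by lia.
    by rewrite /=; move: (100 * (4 * K + 10)) => C; lia.
  by rewrite vz' /= vz; lia.
exists (false :: z); split; last by rewrite /=; lia.
  move: le_x sz => /= le_x sz; run body_mul => //.
  have : 100 * (size y + (size z).+1).+1 + 50 <= 100 * (4 * K + 10) by lia.
    by rewrite /=; move: (100 * (4 * K + 10)) => C; lia.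
by rewrite /= vz; lia.
Qed.

(** Digits come least significant first, so a later difference overrides the outcome [c] of the
    earlier ones. *)
Lemma computes_cmp c x y :
  computes f_cmp (Node (enc_bool c) (Node (enc_bits x) (enc_bits y)))
    (enc_bool (if bits_val x == bits_val y then c
               else bits_val x < bits_val y))
    (100 * (size x + size y).+1).
Proof.
have [m] := ubnP (size x + size y); elim: m c x y => // m IH c x y le_m.
case E: ((size x == 0) && (size y == 0)).
  move: E; rewrite !size_eq0 => /andP[/eqP-> /eqP->] /=.
  by case: c; run body_cmp; [| lia | | lia].
have {}E : 0 < size x + size y by move: E; lia.
have := IH (if head false x == head false y then c else head false y)
           (behead x) (behead y).
rewrite !size_behead => /(_ ltac:(move: E le_m; lia)).
set r := (X in computes _ _ X _) => Hz.
have -> : enc_bool (if bits_val x == bits_val y then c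
                    else bits_val x < bits_val y) = r.
  rewrite /r (bits_val_head x) (bits_val_head y).
  move: (bits_val (behead x)) (bits_val (behead y)) => X Y.
  by congr enc_bool; case: (head _ x) (head _ y) (c) => [] [] [] /=;
     do ?[case: ifP]; lia.
move: r Hz => r.
case: x y E {IH le_m} => [|[] x] [|[] y] // _; case: c => /= Hz;
  by run body_cmp; [| rewrite /=; lia].
Qed.

Lemma bits_val_bits k : bits_val (bits k) = k.
Proof.
have H n : k < 2 ^ n -> bits_val (mkseq (fun i => odd (k %/ 2 ^ i)) n) = k.
  elim: n k => [|n IH] k lt_k; first by move: lt_k; case: k.
  rewrite /mkseq /= (iotaDl 1 0) -map_comp divn1.
  rewrite (eq_map (g := fun i => odd (k./2 %/ 2 ^ i))); last first.
    by move=> i /=; rewrite expnD expn1 divnMA divn2.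
  by rewrite IH ?odd_double_half //; move: lt_k; rewrite expnS; lia.
by apply: H; exact: up_logP.
Qed.

Definition bits_bounded K (q : rat) :=
  size (bits `|numq q|) <= K /\ size (bits `|denq q|) <= K.

Lemma le_rat_absz (p q : rat) : (0 <= p)%R -> (0 <= q)%R ->
  (p <= q)%R = (`|numq p| * `|denq q| <= `|numq q| * `|denq p|).
Proof.
rewrite -!numq_ge0 => p0 q0; rewrite -lez_nat !PoszM !gez0_abs //.
exact: le_ratE.
Qed.

(** Two products, then a comparison of two numbers of at most [3 * K] digits each, whence
    [600 * K]. *)
Definition time_le_rat K := 2 * (K.+1 * (100 * (4 * K + 10))) + 600 * K + 200.

Lemma computes_le_rat K p q :
  bits_bounded K p -> bits_bounded K q -> (0 <= p)%R -> (0 <= q)%R ->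
  computes f_le_rat (Node (enc_rat p) (enc_rat q)) (enc_bool (p <= q)%R)
           (time_le_rat K).
Proof.
move=> [np dp] [nq dq] p0 q0.
have [z [Hz vz sz]] := computes_mul np dq.
have [z' [Hz' vz' sz']] := computes_mul nq dp.
have := computes_cmp true z z'.
have -> : (if bits_val z == bits_val z' then true else bits_val z < bits_val z')
        = (p <= q)%R.
  by rewrite vz vz' !bits_val_bits le_rat_absz // [RHS]leq_eqVlt; case: eqP.
move=> Hcmp; run body_le_rat => //.
rewrite /time_le_rat.
have := leq_mul np (leqnn (100 * (4 * K + 10))).
have := leq_mul nq (leqnn (100 * (4 * K + 10))).
have := leq_mul np (leqnn (100 * (4 * K + 10))).
have := leq_mul nq (leqnn (100 * (4 * K + 10))).
by move: (100 * (4 * K + 10)) => C; lia.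
Qed.

(** * Positions and blocks on the machine *)

Definition item := (nat * rat)%type.

Definition enc_item (x : item) := Node (unary x.1) (enc_rat x.2).

Definition item_bounded K (x : item) :=
  [/\ x.1 <= K, bits_bounded K x.2 & (0 <= x.2)%R].

Definition item_precedes (x y : item) : bool :=
  if (x.2 <= y.2)%R then (y.2 <= x.2)%R && (x.1 < y.1) else true.

Definition time_precedes K := 2 * time_le_rat K + 40 * K + 200.

Lemma computes_precedes K x y : item_bounded K x -> item_bounded K y ->
  computes f_precedes (Node (enc_item x) (enc_item y))
    (enc_bool (item_precedes x y)) (time_precedes K).
Proof.
move=> [xK bx x0] [yK by_ y0].
have H1 := computes_le_rat bx by_ x0 y0.
have H2 := computes_le_rat by_ bx y0 x0.
have H3 := computes_leq y.1 x.1.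
rewrite /item_precedes ltnNge /time_precedes.
case: (x.2 <= y.2)%R H1 => H1; last by run body_precedes; [|lia].
case: (y.2 <= x.2)%R H2 => H2; last by run body_precedes; [|lia].
by case: (y.1 <= x.1) H3 => H3; (run body_precedes; [|lia]).
Qed.

Definition time_position K := K.+1 * (time_precedes K + 50).

Lemma computes_position K x s : item_bounded K x ->
  {in s, forall y, item_bounded K y} -> size s <= K ->
  computes f_position (Node (enc_item x) (enc_seq (map enc_item s)))
    (unary (count (item_precedes^~ x) s)) (time_position K).
Proof.
move=> xK sK le_s.
(* The number of rounds is refined to the actual length, which decreases in the induction, while [K]
   keeps bounding the cost of a round. The later loops are treated alike. *)
apply: computes_le (leq_mul (_ : (size s).+1 <= K.+1) (leqnn _)) => {le_s} //.
elim: s sK => [|y s IH] sK; first by run body_position; [|lia].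
have Hs := IH (fun z zs => sK z (mem_behead (s := y :: s) zs)).
have Hy := computes_precedes (sK y (mem_head _ _)) xK.
rewrite [size (_ :: _)]/= mulSn; move: (_ * _) Hs => A Hs.
by case E: (item_precedes y x) Hy => Hy; run body_position; rewrite ?E //=; lia.
Qed.

Fixpoint div_loop n' r p : nat :=
  if p is p'.+1 then
    if r is r'.+1 then div_loop n' r' p' else (div_loop n' n' p').+1
  else 0.

Lemma div_loopE n' r p : r <= n' -> div_loop n' r p = (p + (n' - r)) %/ n'.+1.
Proof.
elim: p r => [|p IH] r le_r /=; first by rewrite divn_small //; lia.
case: r le_r => [|r] le_r; rewrite IH //; try lia; last by congr (_ %/ _); lia.
by rewrite subnn addn0 subn0 addSnnS divnDr // divnn addn1.
Qed.

Lemma computes_div n' r p :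
  computes f_div (Node (unary n') (Node (unary r) (unary p)))
    (unary (div_loop n' r p)) (p.+1 * 50).
Proof.
elim: p r => [|p IH] r; first by run body_div; [|lia].
case: r => [|r].
  by have H := IH n'; run body_div; [|lia].
by have H := IH r; run body_div; [|lia].
Qed.

Lemma computes_number k (s : seq rat) :
  computes f_number (Node (unary k) (enc_seq (map enc_rat s)))
    (enc_seq (map enc_item (zip (iota k (size s)) s))) ((size s).+1 * 50).
Proof.
elim: s k => [|q s IH] k; first by run body_number; [|lia].
by have H := IH k.+1; run body_number; [|lia].
Qed.

Definition time_blocks K := K.+1 * (time_position K + 50 * K + 200).

Lemma computes_blocks K n' all_s s : {in all_s, forall y, item_bounded K y} ->
  size all_s <= K -> {in s, forall y, item_bounded K y} -> size s <= K ->
  computes f_blocks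
    (Node (unary n') (Node (enc_seq (map enc_item all_s))
                           (enc_seq (map enc_item s))))
    (enc_seq [seq unary (count (item_precedes^~ x) all_s %/ n'.+1) | x <- s])
    (time_blocks K).
Proof.
move=> aK le_a sK le_s.
apply: computes_le (leq_mul (_ : (size s).+1 <= K.+1) (leqnn _)) => {le_s} //.
elim: s sK => [|y s IH] sK; first by run body_blocks; [|lia].
have Hs := IH (fun z zs => sK z (mem_behead (s := y :: s) zs)).
have Hp := computes_position (sK y (mem_head _ _)) aK le_a.
have := computes_div n' n' (count (item_precedes^~ y) all_s).
rewrite div_loopE // subnn addn0 => Hd.
have := leq_trans (count_size (item_precedes^~ y) all_s) le_a.
rewrite [size (_ :: _)]/= mulSn; move: (_ * _) Hs => A Hs.
by move=> le_p; run body_blocks; [|lia].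
Qed.

(** * Edge colouring on the machine *)

Definition enc_edge (e : edge) : tree :=
  Node (unary e.1) (Node (unary e.2.1) (unary e.2.2)).

Lemma computes_edges k (s t : seq nat) : size s = size t ->
  computes f_edges
    (Node (unary k) (Node (enc_seq (map unary s)) (enc_seq (map unary t))))
    (enc_seq (map enc_edge (zip (iota k (size s)) (zip s t))))
    ((size s).+1 * 80).
Proof.
elim: s t k => [|l s IH] [|r t] k // => [_|[eq_st]].
  by run body_edges; [|lia].
by have H := IH t k.+1 eq_st; run body_edges; [|lia].
Qed.

Definition enc_coloured (w : coloured) : tree := Node (unary w.1) (enc_edge w.2).

Definition enc_side (s : option bool) : tree :=
  if s is Some b then Node (enc_bool b) Leaf else Leaf.

Definition enc_query s k c : tree := Node (enc_side s) (Node (unary k) (unary c)).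

Definition time_hit K := 200 * K + 400.

Lemma computes_hit K s k c w : k <= K -> c <= K ->
  computes f_hit (Node (enc_query s k c) (enc_coloured w))
    (enc_bool (hit s k c w)) (time_hit K).
Proof.
move=> kK cK.
have H1 := computes_leq (key s w.2) k.
have H2 := computes_leq k (key s w.2).
have H3 := computes_leq w.1 c.
have H4 := computes_leq c w.1.
rewrite /time_hit.
have -> : hit s k c w = [&& key s w.2 <= k, k <= key s w.2, w.1 <= c & c <= w.1].
  by rewrite /hit !eqn_leq -andbA.
case E1: (key s w.2 <= k) H1 => H1;
case E2: (k <= key s w.2) H2 => H2;
case E3: (w.1 <= c) H3 => H3; case E4: (c <= w.1) H4 => H4;
clear E1 E2 E3 E4;
case: s H1 H2 => [[]|] H1 H2; rewrite /key in H1 H2;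
by (run body_hit; [|lia]).
Qed.

Definition enc_kick (o : option (coloured * seq coloured)) : tree :=
  if o is Some (y, V) then Node (enc_coloured y) (enc_seq (map enc_coloured V))
  else Leaf.

Definition time_kick K := K.+1 * (time_hit K + 100).

Lemma computes_kick_cons w r : computes f_kick_cons
  (Node (enc_coloured w) (enc_kick r))
  (enc_kick (if r is Some (y, V) then Some (y, w :: V) else None)) 20.
Proof. by case: r => [[y V]|]; run body_kick_cons. Qed.

Lemma computes_kick K s k c U : k <= K -> c <= K -> size U <= K ->
  computes f_kick (Node (enc_query s k c) (enc_seq (map enc_coloured U)))
    (enc_kick (kick s k c U)) (time_kick K).
Proof.
move=> kK cK le_U.
apply: computes_le (leq_mul (_ : (size U).+1 <= K.+1) (leqnn _)) => {le_U} //.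
elim: U => [|w U IH]; first by run body_kick; [|lia].
have Hc := computes_kick_cons w (kick s k c U).
have Hh := computes_hit s w kK cK.
rewrite [size (_ :: _)]/= mulSn; move: (_ * _) IH => A IH.
case E: (hit s k c w) Hh => Hh; first by run body_kick; rewrite ?E //; lia.
by run body_kick; rewrite ?E //; lia.
Qed.

Lemma free_colour_le s k n U : free_colour s k n U <= n.
Proof. by elim: n => //= n IH; case: ifP => _ //; apply: leqW. Qed.

Definition edge_bounded K (e : edge) := forall s, key s e <= K.

Definition time_insert K := K.+1 * (time_kick K + 300).

(** The program has no fuel: it stops when the search fails. With [m] at least the length of [U],
    the fuel of [insert] never stops it earlier, since each kick shortens the list. *)
Lemma computes_insert K m s a b x U : size U <= m -> size U <= K ->
  a <= K -> b <= K -> edge_bounded K x ->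
  {in map snd U, forall e, edge_bounded K e} ->
  computes f_insert
    (Node (Node (enc_bool s) (Node (unary a) (unary b)))
          (Node (enc_edge x) (enc_seq (map enc_coloured U))))
    (enc_seq (map enc_coloured (insert m s a b x U))) (time_insert K).
Proof.
move=> le_m le_U aK bK xK UK.
apply: computes_le (leq_mul (_ : (size U).+1 <= K.+1) (leqnn _)) => //.
elim: m s a b x U aK bK le_m le_U xK UK => [|m IH] s a b x U aK bK le_m le_U xK UK.
  move: le_m; rewrite leqn0 size_eq0 => /eqP U0; rewrite U0 in le_U *.
  have := computes_kick (Some (~~ s)) (U := [::]) (xK (Some (~~ s))) aK le_U.
  move: (time_kick K) => T Hk.
  have Hs : computes f_insert_step (Node Leaf
     (Node (Node (enc_bool s) (Node (unary a) (unary b)))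
          (Node (enc_edge x) Leaf)))
     (enc_seq [:: enc_coloured (a, x)]) 50 by run body_insert_step.
  by case: s Hk Hs => Hk Hs; (run body_insert; [|lia]).
have := computes_kick (Some (~~ s)) (xK (Some (~~ s))) aK le_U.
rewrite /=; case: kickP => [y V _ eU|_] Hk.
  have szU : size U = (size V).+1 by rewrite (perm_size eU).
  have UV : {subset map snd (y :: V) <= map snd U}.
    by move=> e; rewrite (perm_mem (perm_map snd eU)).
  have VK : {in map snd V, forall e, edge_bounded K e}.
    by move=> e eV; apply/UK/UV; rewrite inE eV orbT.
  have leVm : size V <= m by rewrite szU in le_m.
  have leVK : size V <= K by rewrite szU in le_U; apply: ltnW.
  have := IH (~~ s) b a y.2 V bK aK leVm leVK (UK y.2 (UV y.2 (mem_head _ _))) VK.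
  rewrite szU [_.+2 * _]mulSn => HV.
  move: (time_kick K) Hk HV => T Hk HV.
  move: (_ * (_ + _)) HV => A HV.
  have Hs : computes f_insert_step (Node (enc_kick (Some (y, V)))
     (Node (Node (enc_bool s) (Node (unary a) (unary b)))
          (Node (enc_edge x) (enc_seq (map enc_coloured U)))))
     (enc_seq (map enc_coloured ((a, x) :: insert m (~~ s) b a y.2 V))) (A + 100).
    by case: s HV {Hk} => HV; (run body_insert_step; [|lia]).
  by case: s Hk Hs {HV} => Hk Hs; (run body_insert; [|lia]).
move: (time_kick K) Hk => T Hk.
have Hs : computes f_insert_step (Node Leaf
     (Node (Node (enc_bool s) (Node (unary a) (unary b)))
          (Node (enc_edge x) (enc_seq (map enc_coloured U)))))
     (enc_seq (map enc_coloured ((a, x) :: U))) 50.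
  by run body_insert_step.
by case: s Hk Hs => Hk Hs; (run body_insert; [|lia]).
Qed.

Definition time_free K := K.+1 * (time_kick K + 100).

Lemma computes_free K s k n U : k <= K -> n <= K -> size U <= K ->
  computes f_free
    (Node (Node (enc_side s) (unary k))
          (Node (unary n) (enc_seq (map enc_coloured U))))
    (unary (free_colour s k n U)) (time_free K).
Proof.
move=> kK nK le_U.
apply: computes_le (leq_mul (_ : n.+1 <= K.+1) (leqnn _)) => //.
elim: n nK => [|n IH] nK; first by run body_free; [|lia].
have Hf := IH (ltnW nK).
have := computes_kick s kK (ltnW nK) le_U.
rewrite [free_colour _ _ _ _]/= mulSn; move: (_ * _) Hf => A Hf.
by case: kick => [[y V]|] Hk; (run body_free; [|lia]).
Qed.

Definition time_colour K := K.+1 * (time_insert K + 2 * time_free K + 200).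

Lemma computes_colour K n es : n <= K -> size es <= K ->
  {in es, forall e, edge_bounded K e} ->
  computes f_colour (Node (unary n) (enc_seq (map enc_edge es)))
    (enc_seq (map enc_coloured (colour n es))) (time_colour K).
Proof.
move=> nK le_es esK.
apply: computes_le (leq_mul (_ : (size es).+1 <= K.+1) (leqnn _)) => //.
elim: es le_es esK => [|e es IH] le_es esK; first by run body_colour; [|lia].
have es'K := fun f fes => esK f (mem_behead (s := e :: es) fes).
have eK := esK e (mem_head _ _).
have Hc := IH (ltnW le_es) es'K.
have WK : {in map snd (colour n es), forall e, edge_bounded K e}.
  by move=> f; rewrite (perm_mem (colour_edges n es)); apply: es'K.
have le_W : size (colour n es) <= K.
  by rewrite -(size_map snd) (perm_size (colour_edges n es)) ltnW.
have Hf s := computes_free s (eK s) nK le_W.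
have Hi := computes_insert true (leqnn _) le_W
  (leq_trans (free_colour_le (Some true) (key (Some true) e) n (colour n es)) nK)
  (leq_trans (free_colour_le (Some false) (key (Some false) e) n (colour n es)) nK) eK WK.
have Hs : computes f_colour_step
    (Node (unary n) (Node (enc_edge e) (enc_seq (map enc_coloured (colour n es)))))
    (enc_seq (map enc_coloured (colour n (e :: es))))
    (time_insert K + 2 * time_free K + 120).
  move: (time_insert K) (time_free K) Hi Hf => T T' Hi Hf.
  have Hf1 := Hf (Some true); have Hf2 := Hf (Some false).
  by run body_colour_step; [|lia].
rewrite [size (_ :: _)]/= mulSn; move: (_ * _) Hc => A Hc.
move: (time_insert K) (time_free K) Hs {Hi Hf} => T T' Hs.
by run body_colour; [|lia].
Qed.

Definition time_row K := K.+1 * (time_kick K + 100).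

Lemma computes_row K k es W : k <= K -> size es <= K -> size W <= K ->
  {in es, forall e, edge_bounded K e} ->
  computes f_row
    (Node (unary k) (Node (enc_seq (map enc_edge es))
                          (enc_seq (map enc_coloured W))))
    (enc_seq [seq enc_bool (has (hit None e.1 k) W) | e <- es]) (time_row K).
Proof.
move=> kK le_es le_W esK.
apply: computes_le (leq_mul (_ : (size es).+1 <= K.+1) (leqnn _)) => //.
elim: es {le_es} esK => [|e es IH] esK; first by run body_row; [|lia].
have Hr := IH (fun f fes => esK f (mem_behead (s := e :: es) fes)).
have := computes_kick None (esK e (mem_head _ _) None) kK le_W.
rewrite !map_cons -(kick_isSome None e.1 k W).
rewrite [size (_ :: _)]/= mulSn; move: (_ * _) Hr => A Hr.
by case: kick => [[y V]|] Hk; (run body_row; [|lia]).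
Qed.

Definition time_rows K := K.+1 * (time_row K + 100).

Lemma computes_rows K k (s : seq tree) es W :
  k + size s <= K -> size es <= K -> size W <= K ->
  {in es, forall e, edge_bounded K e} ->
  computes f_rows
    (Node (unary k) (Node (enc_seq s) (Node (enc_seq (map enc_edge es))
                                            (enc_seq (map enc_coloured W)))))
    (enc_seq [seq enc_seq [seq enc_bool (has (hit None e.1 j) W) | e <- es]
             | j <- iota k (size s)]) (time_rows K).
Proof.
move=> le_s le_es le_W esK.
have le_s' : size s <= K by lia.
apply: computes_le (leq_mul (_ : (size s).+1 <= K.+1) (leqnn _)) => {le_s'} //.
elim: s k le_s => [|x s IH] k le_s; first by run body_rows; [|lia].
have leS : k.+1 + size s <= K by rewrite addSnnS.
have kK : k <= K by apply: leq_trans (leq_addr _ _) le_s.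
have Hs := IH k.+1 leS.
have Hr := computes_row kK le_es le_W esK.
rewrite [size (_ :: _)]/= mulSn; move: (_ * _) Hs => A Hs.
by run body_rows; [|lia].
Qed.

Lemma computes_length (s : seq tree) :
  computes f_length (enc_seq s) (unary (size s)) ((size s).+1 * 20).
Proof.
elim: s => [|x s IH]; first by run body_length; [|lia].
by run body_length; [|lia].
Qed.

Definition time_solve K := time_rows K + time_colour K + 20 * K + 100.

Lemma computes_solve K (s : seq tree) es :
  size s <= K -> size es <= K -> {in es, forall e, edge_bounded K e} ->
  computes f_solve (Node (enc_seq s) (enc_seq (map enc_edge es)))
    (enc_seq [seq enc_seq [seq enc_bool (has (hit None e.1 j)
                                             (colour (size s) es)) | e <- es]
             | j <- iota 0 (size s)]) (time_solve K).
Proof.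
move=> le_s le_es esK.
have Hl := computes_length s.
have Hc := computes_colour le_s le_es esK.
have le_W : size (colour (size s) es) <= K.
  by rewrite -(size_map snd) (perm_size (colour_edges _ es)).
have Hr := @computes_rows K 0 s es (colour (size s) es) le_s le_es le_W esK.
rewrite /time_solve; run body_solve => //.
by move: (time_rows K) (time_colour K) => T T'; lia.
Qed.

(** * The whole program on lists of values *)

Definition valuation_items (s : seq rat) : seq item := zip (iota 0 (size s)) s.

Definition item_blocks n (s : seq item) : seq nat :=
  [seq count (item_precedes^~ x) s %/ n | x <- s].

Definition instance_edges n (s t : seq rat) : seq edge :=
  zip (iota 0 (size s)) (zip (item_blocks n (valuation_items s))
                             (item_blocks n (valuation_items t))).

Lemma size_valuation_items s : size (valuation_items s) = size s.
Proof. by rewrite size_zip size_iota minnn. Qed.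

Lemma size_item_blocks n s : size (item_blocks n s) = size s.
Proof. exact: size_map. Qed.

Lemma size_instance_edges n s t : size t = size s ->
  size (instance_edges n s t) = size s.
Proof.
move=> e.
by rewrite !size_zip !size_item_blocks !size_valuation_items e size_iota !minnn.
Qed.

Lemma mem_zip (S T : eqType) (s : seq S) (t : seq T) x y :
  (x, y) \in zip s t -> x \in s /\ y \in t.
Proof.
elim: s t => [|a s IH] [|b t] //=; rewrite !inE xpair_eqE.
case/orP=> [/andP[/eqP-> /eqP->]|/IH[-> ->]]; last by rewrite !orbT.
by rewrite !eqxx.
Qed.

Lemma instance_edges_bounded n s t : size t = size s ->
  {in instance_edges n s t, forall e, edge_bounded (size s) e}.
Proof.
move=> eq_ts [i [l r]] /mem_zip[i_s /mem_zip[]].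
have H x (q : seq rat) : size q = size s ->
    x \in item_blocks n (valuation_items q) -> x <= size s.
  move=> <- /mapP[y _ ->]; apply: leq_trans (leq_div _ _) _.
  by apply: leq_trans (count_size _ _) _; rewrite size_valuation_items.
move=> /(H _ _ erefl) ls /(H _ _ eq_ts) rs; case=> [[]|] //.
by move: i_s; rewrite mem_iota add0n /key => /andP[_ /ltnW].
Qed.

Lemma valuation_items_bounded K s : size s <= K ->
  {in s, forall q, bits_bounded K q /\ (0 <= q)%R} ->
  {in valuation_items s, forall x, item_bounded K x}.
Proof.
move=> le_s sK [i q] /mem_zip[]; rewrite mem_iota add0n => /andP[_ lt_i].
by case/sK=> qK q0; split => //=; apply: leq_trans (ltnW lt_i) le_s.
Qed.

Definition time_main K := time_solve K + 2 * time_blocks K + 500 * K + 1000.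

Lemma computes_main K (s t : seq rat) (others : seq tree) :
  let n := (size others).+1 in
  let es := instance_edges n s t in
  size t = size s -> size s <= K -> n <= K ->
  {in s, forall q, bits_bounded K q /\ (0 <= q)%R} ->
  {in t, forall q, bits_bounded K q /\ (0 <= q)%R} ->
  computes f_main (Node (enc_seq (map enc_rat s))
                        (enc_seq (enc_seq (map enc_rat t) :: others)))
    (enc_seq [seq enc_seq [seq enc_bool (has (hit None e.1 j) (colour n es))
                          | e <- es] | j <- iota 0 n]) (time_main K).
Proof.
move=> n es eq_ts le_s le_n sK tK.
have le_t : size t <= K by rewrite eq_ts.
have isK := valuation_items_bounded le_s sK.
have itK := valuation_items_bounded le_t tK.
have le_is : size (valuation_items s) <= K by rewrite size_valuation_items.
have le_it : size (valuation_items t) <= K by rewrite size_valuation_items.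
have Hl := computes_length (enc_seq (map enc_rat t) :: others).
have Hns := computes_number 0 s.
have Hnt := computes_number 0 t.
have Hbs := computes_blocks (size others) isK le_is isK le_is.
have Hbt := computes_blocks (size others) itK le_it itK le_it.
have blocksE (q : seq item) :
    [seq unary (count (item_precedes^~ x) q %/ (size others).+1) | x <- q]
    = map unary (item_blocks n q) by rewrite -map_comp.
rewrite !blocksE in Hbs Hbt.
have eq_b : size (item_blocks n (valuation_items s))
          = size (item_blocks n (valuation_items t)).
  by rewrite !size_item_blocks !size_valuation_items.
have He := computes_edges 0 eq_b.
have esK : {in es, forall e, edge_bounded K e}.
  by move=> e /(instance_edges_bounded eq_ts) eK b; apply: leq_trans le_s.
have le_es : size es <= K by rewrite size_instance_edges.
have Hs := @computes_solve K (enc_seq (map enc_rat t) :: others) es le_n le_es esK.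
move: He; rewrite size_item_blocks size_valuation_items => He.
rewrite -/(instance_edges n s t) -/es in He.
rewrite /time_main; move: (time_solve K) (time_blocks K) Hs Hbs Hbt => T T' Hs Hbs Hbt.
run body_main => //.
by rewrite eq_ts /=; move: le_n; rewrite /n; lia.
Qed.

(** * Polynomial bounds *)

Definition polynomial (T : nat -> nat) := exists p : {poly nat}, forall K, T K = p.[K]%R.

Lemma polynomial_const c : polynomial (fun=> c).
Proof. by exists (c%:P)%R => K; rewrite hornerC. Qed.

Lemma polynomial_id : polynomial id.
Proof. by exists 'X%R => K; rewrite hornerX. Qed.

Lemma polynomial_add T T' :
  polynomial T -> polynomial T' -> polynomial (fun K => T K + T' K).
Proof.
by case=> p Tp [p' Tp']; exists (p + p')%R => K; rewrite hornerD Tp Tp'.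
Qed.

Lemma polynomial_mul T T' :
  polynomial T -> polynomial T' -> polynomial (fun K => T K * T' K).
Proof.
by case=> p Tp [p' Tp']; exists (p * p')%R => K; rewrite hornerM Tp Tp'.
Qed.

Lemma polynomial_succ T : polynomial T -> polynomial (fun K => (T K).+1).
Proof. by move/(polynomial_add (polynomial_const 1)). Qed.

Lemma polynomial_time_main : polynomial time_main.
Proof.
rewrite /time_main /time_solve /time_rows /time_row /time_colour /time_insert.
rewrite /time_free /time_kick /time_hit /time_blocks /time_position.
rewrite /time_precedes /time_le_rat.
repeat lazymatch goal with
| |- polynomial (fun=> ?c) => exact: polynomial_const
| |- polynomial (fun K => K) => exact: polynomial_id
| |- polynomial (fun K => (@?T K).+1) => apply: (@polynomial_succ T)
| |- polynomial (fun K => @?T K + @?T' K) => apply: (@polynomial_add T T')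
| |- polynomial (fun K => @?T K * @?T' K) => apply: (@polynomial_mul T T')
end.
Qed.

(** * Agreement of the list computation with the allocation *)

Lemma map_index_uniq (T : eqType) (s : seq T) :
  uniq s -> map (index^~ s) s = iota 0 (size s).
Proof.
move=> us; case: s us => // x s' us; set s := x :: s' in us *.
apply: (@eq_from_nth _ 0) => [|i]; rewrite size_map ?size_iota // => lt_i.
by rewrite (nth_map x) // nth_iota // index_uniq.
Qed.

Lemma zip_map_iota (T : finType) (S : Type) (f : T -> S) :
  zip (iota 0 (size (map f (enum T)))) (map f (enum T))
  = [seq (index x (enum T), f x) | x <- enum T].
Proof.
rewrite size_map -map_index_uniq ?enum_uniq //.
have H s (idx : T -> nat) :
    zip (map idx s) (map f s) = [seq (idx x, f x) | x <- s].
  by elim: s => //= x s ->.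
exact: H.
Qed.

(** Pairing each value with its index in [enum M] makes [item_precedes] on the pairs the same test
    as [precedes] on the goods. *)
Lemma item_blocks_position (M : finType) n (u : M -> rat) :
  item_blocks n (valuation_items (map u (enum M)))
  = [seq position u g %/ n | g <- enum M].
Proof.
rewrite /item_blocks /valuation_items zip_map_iota -map_comp.
apply: eq_map => g /=; congr (_ %/ _); rewrite count_map.
rewrite enumT /position cardE /enum_mem size_filter.
by apply: eq_count => h /=; rewrite inE -enumT.
Qed.

Lemma instance_edges_good (M : finType) n (u v : M -> rat) :
  instance_edges n (map u (enum M)) (map v (enum M)) = good_edges n u v.
Proof.
rewrite /instance_edges !item_blocks_position.
have -> : zip [seq position u g %/ n | g <- enum M]
              [seq position v g %/ n | g <- enum M]
        = [seq (position u g %/ n, position v g %/ n) | g <- enum M].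
  by elim: (enum M) => //= g s ->.
rewrite size_map -(size_map (fun g => (position u g %/ n, position v g %/ n))).
exact: zip_map_iota.
Qed.

Lemma size_le_enc_seq s : size s <= tree_size (enc_seq s).
Proof. by elim: s => //= x s IH; lia. Qed.

Lemma enc_bits_bounded (M : finType) (f : {set M} -> rat) K g :
  tree_size (enc_valuation f) <= K -> bits_bounded K (f [set g]).
Proof.
move=> le_K.
suff: tree_size (enc_rat (f [set g])) <= tree_size (enc_valuation f).
  have size_bits k : size (bits k) <= tree_size (enc_nat k).
    by have := size_le_enc_seq (map enc_bool (bits k)); rewrite (size_map enc_bool).
  move: (size_bits `|numq (f [set g])|) (size_bits `|denq (f [set g])|).
  by move=> bn bd /= le_f; split; lia.
rewrite /enc_valuation; have : g \in enum M by rewrite mem_enum.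
elim: (enum M) => //= h s IH; rewrite inE => /orP[/eqP<-|/IH]; first lia.
by rewrite /=; lia.
Qed.

(** The size of the encoded instance serves as the single bound [K]: it dominates the numbers of
    goods and agents and the digits of the values read. The agent [i0] must head [enum N], as the
    program ranks by the first valuation. *)
Lemma runs_sd_program (N M : finType) (I : fd_instance rat N M) i0 rest :
  enum N = i0 :: rest ->
  let A := allot N M (colour #|N|
             (good_edges #|N| (fun g => market I [set g])
                              (fun g => subjective I i0 [set g]))) in
  computes f_main (enc_instance I) (enc_allocation A)
    (time_main (tree_size (enc_instance I))).
Proof.
move=> eN A; set K := tree_size _.
have le_m : tree_size (enc_valuation (market I)) <= K by rewrite /K /=; lia.
have le_s : tree_size (enc_valuation (subjective I i0)) <= K.
  by rewrite /K /= eN /=; lia.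
have le_M : size (enum M) <= K.
  apply: leq_trans le_m; apply: leq_trans (size_le_enc_seq _).
  by rewrite size_map.
have eqN : #|N| = (size (map (fun i => enc_valuation (subjective I i)) rest)).+1.
  by rewrite cardE eN /= size_map.
have le_N : #|N| <= K.
  have := size_le_enc_seq [seq enc_valuation (subjective I i) | i <- enum N].
  by rewrite size_map -cardE /K /=; lia.
have val_bounded (f : {set M} -> rat) :
    additive_valuation f -> tree_size (enc_valuation f) <= K ->
    {in [seq f [set g] | g <- enum M], forall q, bits_bounded K q /\ (0 <= q)%R}.
  by move=> [f0 _] le_f _ /mapP[g _ ->]; split; first exact: enc_bits_bounded.
have := @computes_main K [seq market I [set g] | g <- enum M]
  [seq subjective I i0 [set g] | g <- enum M]
  (map (fun i => enc_valuation (subjective I i)) rest).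
cbv zeta; rewrite -eqN !(size_map _ (enum M)) instance_edges_good => /(_ erefl le_M le_N).
move=> /(_ (val_bounded _ (marketP I) le_m) (val_bounded _ (subjectiveP I i0) le_s)).
set x := (X in computes _ X); set y := (X in computes _ _ X _).
have -> : x = enc_instance I.
  by rewrite /x /enc_instance /enc_valuation eN /= -!map_comp.
suff -> : y = enc_allocation A by [].
rewrite /y /enc_allocation cardE -map_index_uniq ?enum_uniq // -!map_comp.
congr enc_seq; apply: eq_map => i /=; congr enc_seq; rewrite -map_comp.
by apply: eq_map => g /=; rewrite ffunE inE cardE.
Qed.

Local Open Scope ring_scope.

Theorem theorem3 :
  (forall (R : realFieldType) (N M : finType) (I : fd_instance R N M),
     (0 < #|N|)%N -> same_subjective_ranking I ->
     exists A : {ffun N -> {set M}},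
       [/\ allocation A, SD_EF1_subjective I A & SD_EF1_market I A])
  /\
  poly_time_solvable
    (fun N M I => (0 < #|N|)%N /\ same_subjective_ranking I)
    (fun N M I A =>
       [/\ allocation A, SD_EF1_subjective I A & SD_EF1_market I A]).
Proof.
split=> [R N M I /card_gt0P[i0 _] sameI|].
  by exists (allot N M (colour #|N| (good_edges #|N| (fun g => market I [set g])
               (fun g => subjective I i0 [set g])))); apply: allotP.
have [p time_p] := polynomial_time_main.
exists sd_program, p => N M I [N0 sameI].
case eN: (enum N) => [|i0 rest]; first by move: N0; rewrite cardE eN.
have [t run_t le_t] := runs_sd_program I eN.
exists (allot N M (colour #|N| (good_edges #|N| (fun g => market I [set g])
               (fun g => subjective I i0 [set g])))), t; split=> //.
- exact: allotP.
- by rewrite -time_p.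
Qed.
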